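(* The $t$-shuffle product $\overset{t}{\sqcup\!\sqcup}$ is commutative and associative, $\mathfrak{h}_t$ is a commutative and associative algebra under this product, and $\mathfrak{h}_t^1$ and $\mathfrak{h}^0_t$ are subalgebras. Moreover, the $\mathbb{Q}[t]$-linear map $Z_t:(\mathfrak{h}_t^0,\overset{t}{\sqcup\!\sqcup})\rightarrow\mathbb{R}[t]$ is an algebra homomorphism.
   Context: Let $A=\{x,y\}$ be an alphabet of two noncommutative letters, $A^{\ast}$ the set of words (including the empty word $1$), $\mathfrak{h}_t=\mathbb{Q}[t]\langle A\rangle$, $\mathfrak{h}_t^1=\mathbb{Q}[t]+\mathfrak{h}_ty$, $\mathfrak{h}_t^0=\mathbb{Q}[t]+x\mathfrak{h}_ty$, and $z_k=x^{k-1}y$. For an admissible index $\mathbf{k}=(k_1,\ldots,k_n)$ ($k_1\geqslant2$), $\zeta^t(\mathbf{k})=\sum_{\mathbf{p}}t^{n-\mathrm{dep}(\mathbf{p})}\zeta(\mathbf{p})$, where $\mathbf{p}$ runs over all sequences $(k_1\Box\cdots\Box k_n)$ with each $\Box$ a comma or a plus, and $\zeta$ is the multiple zeta value. $Z_t:\mathfrak{h}_t^0\to\mathbb{R}[t]$ is $\mathbb{Q}[t]$-linear with $Z_t(1)=1$, $Z_t(z_{k_1}\cdots z_{k_n})=\zeta^t(k_1,\ldots,k_n)$. The $t$-shuffle product $\overset{t}{\sqcup\!\sqcup}$ is the $\mathbb{Q}[t]$-bilinear product on $\mathfrak{h}_t$ with $1\overset{t}{\sqcup\!\sqcup} w=w\overset{t}{\sqcup\!\sqcup}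 1=w$ and $aw_1\overset{t}{\sqcup\!\sqcup} bw_2=a(w_1\overset{t}{\sqcup\!\sqcup} bw_2)+b(aw_1\overset{t}{\sqcup\!\sqcup} w_2)-\delta(w_1)\rho(a)bw_2-\delta(w_2)\rho(b)aw_1$ for $w,w_1,w_2\in A^\ast$, $a,b\in A$, where $\delta(w)=1$ if $w=1$ and $0$ otherwise, and $\rho(x)=0$, $\rho(y)=tx$. *)

(* Defs.v *)
From HB Require Import structures.
From mathcomp Require Import all_boot all_order ssralg ssrnum ssrint rat poly.
From mathcomp Require Import finmap.
From mathcomp Require Import monalg.
From mathcomp Require Import classical_sets reals constructive_ereal esum.

Set Implicit Arguments.
Unset Strict Implicit.
Unset Printing Implicit Defensive.

Import GRing.Theory.
Local Open Scope ring_scope.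

Inductive letter := lx | ly.

Definition letter_is_y (a : letter) : bool := if a is ly then true else false.
Definition letter_of_bool (b : bool) : letter := if b then ly else lx.
Lemma letter_is_yK : cancel letter_is_y letter_of_bool.
Proof. by case. Qed.
HB.instance Definition _ := Countable.copy letter (can_type letter_is_yK).

(* Q[t]<x, y>, with 'X : {poly rat} standing for t; the ring multiplication of
   this type is concatenation, and its unit 1 is the empty word. *)
Notation ht := {malg {poly rat}[{fmonom letter}]}.

Definition word (w : seq letter) : ht := mkmalgU (FMonom w) 1.

Definition ht1 (u : ht) : Prop :=
  exists (c : {poly rat}) (v : ht), u = c%:A + v * word [:: ly].

Definition ht0 (u : ht) : Prop :=
  exists (c : {poly rat}) (v : ht),
    u = c%:A + word [:: lx] * v * word [:: ly].

Definition delta (w : seq letter) : ht := (w == [::])%:R.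

Definition rho (a : letter) : ht :=
  if a is ly then 'X *: word [:: lx] else 0.

Fixpoint tshuffle_word (u : seq letter) : seq letter -> ht :=
  match u with
  | [::] => word
  | a :: w1 =>
      fix tshuffle_u (v : seq letter) : ht :=
        match v with
        | [::] => word (a :: w1)
        | b :: w2 =>
            word [:: a] * tshuffle_word w1 (b :: w2)
            + word [:: b] * tshuffle_u w2
            - delta w1 * rho a * word (b :: w2)
            - delta w2 * rho b * word (a :: w1)
        end
  end.

Definition tshuffle (u v : ht) : ht :=
  \sum_(m <- msupp u) \sum_(n <- msupp v)
    (mcoeff m u * mcoeff n v) *: tshuffle_word m n.

Lemma word0 : word [::] = 1.
Proof. by rewrite /word -fmoneE. Qed.

Lemma word_cat (u v : seq letter) : word (u ++ v) = word u * word v.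
Proof.
rewrite /word -[RHS]/(fgmul _ _) fgmulUU mulr1; congr mkmalgU.
by apply: val_inj; rewrite /= fmM.
Qed.

Lemma tshuffle_wordE (u v : seq letter) :
  tshuffle (word u) (word v) = tshuffle_word u v.
Proof.
rewrite /tshuffle /word !msuppU oner_eq0 !big_seq_fset1.
by rewrite !mcoeffUU mulr1 scale1r.
Qed.

Lemma tshuffle1word (w : seq letter) :
  tshuffle 1 (word w) = word w /\ tshuffle (word w) 1 = word w.
Proof. by rewrite -word0 !tshuffle_wordE; split=> //; case: w. Qed.

Lemma tshuffle_cons (a b : letter) (w1 w2 : seq letter) :
  tshuffle (word (a :: w1)) (word (b :: w2)) =
    word [:: a] * tshuffle (word w1) (word (b :: w2))
    + word [:: b] * tshuffle (word (a :: w1)) (word w2)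
    - delta w1 * rho a * word (b :: w2)
    - delta w2 * rho b * word (a :: w1).
Proof. by rewrite !tshuffle_wordE. Qed.

Definition is_subalgebra (mul : ht -> ht -> ht) (V : ht -> Prop) : Prop :=
  [/\ V 1,
      forall (c : {poly rat}) (u v : ht), V u -> V v -> V (c *: u + v)
    & forall u v : ht, V u -> V v -> V (mul u v)].

Definition zword (k : seq nat) : seq letter :=
  flatten [seq rcons (nseq i.-1 lx) ly | i <- k].

(* Left inverse of zword; letters x after the last y are dropped (such words
   do not occur in ht0), and n counts the letters x already read. *)
Fixpoint index_of (n : nat) (w : seq letter) : seq nat :=
  match w with
  | [::] => [::]
  | lx :: w' => index_of n.+1 w'
  | ly :: w' => n.+1 :: index_of 0 w'
  end.

Lemma zwordK (k : seq nat) : all (leq 1) k -> index_of 0 (zword k) = k.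
Proof.
elim: k => //= i k IHk /andP[i_gt0 /IHk{}IHk].
have idx n j w : index_of n (rcons (nseq j lx) ly ++ w)
    = (n + j).+1 :: index_of 0 w.
  by elim: j n => [|j IHj] n /=; rewrite ?addn0 // IHj addSnnS.
by rewrite [zword _]/(_ ++ zword k) idx IHk add0n prednK.
Qed.

(* contract k s b is the sequence (k [] s_1 [] ... [] s_m), where the i-th box
   is a plus if the i-th entry of b is true, and a comma otherwise. *)
Fixpoint contract (k : nat) (s : seq nat) (b : seq bool) : seq nat :=
  match s, b with
  | l :: s', true :: b' => contract (k + l) s' b'
  | l :: s', false :: b' => k :: contract l s' b'
  | _, _ => [:: k]
  end.

Section Zeta.
Variable R : realType.

(* The sum over all m_1 > ... > m_n >= 1; the terms are nonnegative, so esum is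
   the sum of the series, which is finite when k_1 >= 2 and all k_i >= 1. *)
Definition zeta (k : seq nat) : R :=
  fine (\esum_(m in [set m : seq nat | [/\ size m = size k,
                                          sorted gtn m & all (leq 1) m]])
          (\prod_(i < size k) (nth 0%N m i)%:R ^- nth 0%N k i)%:E)%E.

Definition zetat (k : seq nat) : {poly R} :=
  if k is k1 :: s then
    \sum_(b : (size s).-tuple bool)
      'X ^+ (size k - size (contract k1 s b)) * (zeta (contract k1 s b))%:P
  else 1.

Definition qt_to_rt (c : {poly rat}) : {poly R} := map_poly ratr c.

(* Z_t, extended linearly to all of ht; only its restriction to ht0, spanned by
   1 and the words x ... y, is meaningful. *)
Definition Zt (u : ht) : {poly R} :=
  mmap qt_to_rt (fun m : {fmonom letter} => zetat (index_of 0 m)) u.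

Lemma Zt_zword (k : seq nat) :
  all (leq 1) k -> Zt (word (zword k)) = zetat k.
Proof.
move=> k_gt0; rewrite /Zt mmapE /word msuppU oner_eq0 big_seq_fset1 mcoeffUU.
by rewrite /qt_to_rt rmorph1 mul1r zwordK.
Qed.

End Zeta.

(* Main.v *)
(** The t-shuffle product obeys the usual associativity induction: expanding
    [(au * bv) * cw] with the recursion, with corrections supported on empty
    words, gives an expression that is cyclically symmetric up to associativity
    for shorter words.

    For the homomorphism property, fix a real [t >= 0] and attach to a word [w]
    the coefficients [phi t w n] of a t-analogue of the multiple polylogarithm:
    [phi (xw) n = phi w n / n] and
    [phi (yw) n = (\sum_(m < n) phi w m + t * phi w n) / n].  Multiplication by
    [n] is a derivation of the convolution product of sequences (it is [z d/dz]
    on generating series), which gives by induction that the convolution of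
    [phi u] and [phi v] is the sequence attached to the t-shuffle of [u] and [v];
    no iterated integral is needed.  Summing over [n] (the value at [z = 1], with
    a Cauchy product of nonnegative series) yields multiplicativity of
    [Z_t] evaluated at [t].  Two polynomials which agree at all natural numbers
    are equal. *)

From HB Require Import structures.
From mathcomp Require Import all_boot all_order ssralg ssrnum ssrint rat poly.
From mathcomp Require Import finmap monalg.
From mathcomp Require Import ring lra.
From mathcomp Require Import boolp classical_sets functions cardinality fsbigop.
From mathcomp Require Import reals constructive_ereal topology normedtype.
From mathcomp Require Import sequences esum.
Require Import Defs.
Set Implicit Arguments.
Unset Strict Implicit.
Unset Printing Implicit Defensive.
Import Order.TTheory GRing.Theory Num.Theory.
Import numFieldNormedType.Exports.
Local Open Scope classical_set_scope.
Local Open Scope ring_scope.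

(** * Associativity of shuffle products with corrections at the empty word *)

Section CorrectedShuffle.
Variables (K : comNzRingType) (A : lalgType K) (L : eqType).
(* [W] embeds the words, [eps] reads the coefficient of the empty word. *)
Variables (W : seq L -> A) (eps : A -> K) (rho : L -> A) (T : A -> A -> A).
Variables (x : L) (r : L -> K).
Hypothesis scalerArK : forall (c : K) (u v : A), u * (c *: v) = c *: (u * v).
Hypothesis W_ind : forall P : A -> Prop, P 0 ->
  (forall c u v, P u -> P v -> P (c *: u + v)) -> (forall w, P (W w)) ->
  forall u, P u.
Hypothesis W_cons : forall a w, W (a :: w) = W [:: a] * W w.
Hypothesis eps_linear : linear_for *%R eps.
Hypothesis eps_W : forall w, eps (W w) = (w == [::])%:R.
Hypothesis eps_mulW : forall a u, eps (W [:: a] * u) = 0.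
Hypothesis rhoE : forall a, rho a = r a *: W [:: x].
Hypothesis TC : commutative T.
Hypothesis T_linear : forall v, linear (T^~ v).
Hypothesis T_nil : forall u, T (W [::]) u = u.
Hypothesis T_cons : forall a b u v, T (W (a :: u)) (W (b :: v)) =
  W [:: a] * T (W u) (W (b :: v)) + W [:: b] * T (W (a :: u)) (W v)
  - (u == [::])%:R * rho a * W (b :: v) - (v == [::])%:R * rho b * W (a :: u).

Let TDl u v w : T (u + v) w = T u w + T v w.
Proof. by have := T_linear w 1 u v; rewrite !scale1r. Qed.

Let T0l w : T 0 w = 0.
Proof. by apply: (addrI (T 0 w)); rewrite addr0 -TDl addr0. Qed.

Let TZl c u w : T (c *: u) w = c *: T u w.
Proof. by have := T_linear w c u 0; rewrite T0l !addr0. Qed.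

Let TBl u v w : T (u - v) w = T u w - T v w.
Proof. by rewrite TDl -scaleN1r TZl scaleN1r. Qed.

Let eps0 : eps 0 = 0.
Proof.
apply: (addrI (eps 0)).
by rewrite addr0 -[X in X + _]mul1r -eps_linear scaler0 addr0.
Qed.

(** A product of words is not a word, so the recursion must be linear in the first tail before it
    can be iterated; [eps u] then replaces the test [u == [::]]. *)
Lemma mulW_shuffle a c u w :
  T (W [:: a] * u) (W (c :: w)) =
    W [:: a] * T u (W (c :: w)) + W [:: c] * T (W [:: a] * u) (W w)
    - eps u *: (rho a * W (c :: w)) - (w == [::])%:R * rho c * (W [:: a] * u).
Proof.
elim/W_ind: u => [|k u v IHu IHv|u].
- by rewrite !mulr0 !T0l !mulr0 eps0 scale0r !subr0 addr0.
- rewrite !mulrDr !scalerArK !T_linear IHu IHv eps_linear scalerDl -scalerA.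
  rewrite !mulrDr !scalerArK !scalerBr !scalerDr !opprD.
  by rewrite !addrA [RHS](ACl (1*3*5*7*2*4*6*8)).
- rewrite -W_cons T_cons eps_W scaler_nat -mulrA mulr_natl.
  reflexivity.
Qed.

(** Every term of [T_cons] starts with a letter, the corrections too, since [rho a] is a multiple of
    [W [:: x]]. This kills the [eps] corrections in the expansion of a triple product. *)
Lemma eps_shuffle b u v : eps (T (W u) (W (b :: v))) = 0.
Proof.
case: u => [|a u]; first by rewrite T_nil eps_W.
have epsD X Y : eps (X + Y) = eps X + eps Y.
  by have := eps_linear 1 X Y; rewrite scale1r mul1r.
have epsN X : eps (- X) = - eps X.
  by apply: (addrI (eps X)); rewrite -epsD !subrr eps0.
rewrite T_cons !(epsD, epsN) !eps_mulW addr0 !add0r -!mulrA !mulr_natl !rhoE.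
have epsZ k X : eps (k *: X) = k * eps X.
  by rewrite -[k *: X]addr0 eps_linear eps0 addr0.
by rewrite -!scaler_nat -!scalerAl !epsZ !eps_mulW !mulr0 oppr0 ?addr0.
Qed.

(* By commutativity of [T], the right-hand side is invariant under cyclic
   permutations of the three words up to associativity for shorter words. *)
Lemma shuffle3 a b c u v w :
  let S := T (W (a :: u)) (W (b :: v)) in
  T S (W (c :: w)) =
    W [:: a] * T (T (W u) (W (b :: v))) (W (c :: w))
    + W [:: b] * T (T (W (a :: u)) (W v)) (W (c :: w))
    + W [:: c] * T S (W w)
    - (u == [::])%:R * rho a * T (W (b :: v)) (W (c :: w))
    - (v == [::])%:R * rho b * T (W (a :: u)) (W (c :: w))
    - (w == [::])%:R * rho c * S.
Proof.
move=> S.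
(* [N X] is what remains of the recursion once the terms coming from the letter [c] are removed. It
   is linear in [X], so the expansion of [S] can be fed in term by term. *)
pose N X := T X (W (c :: w)) - W [:: c] * T X (W w)
  + (w == [::])%:R * rho c * X.
have NE X : T X (W (c :: w)) =
    N X + W [:: c] * T X (W w) - (w == [::])%:R * rho c * X.
  by rewrite /N addrAC addrK subrK.
have NB X Y : N (X - Y) = N X - N Y.
  rewrite /N !TBl !mulrBr !opprD !opprK.
  by rewrite !addrA [LHS](ACl (1*3*5*2*4*6)).
have ND X Y : N (X + Y) = N X + N Y.
  rewrite /N !TDl !mulrDr !opprD.
  by rewrite !addrA [LHS](ACl (1*3*5*2*4*6)).
have NZ k X : N (k *: X) = k *: N X.
  by rewrite /N !TZl !scalerArK scalerDr scalerBr.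
have Nmul d X : N (W [:: d] * X) = W [:: d] * T X (W (c :: w))
    - eps X *: (rho d * W (c :: w)).
  by rewrite /N mulW_shuffle addrAC subrK addrAC addrK.
(* Since [rho e] is a multiple of the letter [x], [Nmul] applies to a correction; its own correction
   vanishes because [f :: X] is not empty. *)
have Nrho d e f X : N ((d == [::] :> seq L)%:R * rho e * W (f :: X)) =
   (d == [::])%:R * rho e * T (W (f :: X)) (W (c :: w)).
  rewrite -!mulrA !mulr_natl -!scaler_nat NZ rhoE -!scalerAl NZ Nmul eps_W.
  by rewrite scale0r subr0.
rewrite NE {1}/S T_cons !NB ND !Nmul !Nrho eps_shuffle.
rewrite (TC (W (a :: u))) eps_shuffle !scale0r !subr0 (TC (W v)).
by rewrite [LHS](ACl (1*2*5*3*4*6)).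
Qed.

Lemma shuffle_assoc : associative T.
Proof.
have W_assoc u v w : T (T (W u) (W v)) (W w) = T (W u) (T (W v) (W w)).
  have [n] := ubnP (size u + size v + size w).
  elim: n => // n IHn in u v w *; rewrite ltnS => le_n.
  case: u le_n => [|a u] le_n; first by rewrite !T_nil.
  case: v le_n => [|b v] le_n; first by rewrite T_nil (TC _ (W [::])) T_nil.
  case: w le_n => [|c w] le_n; first by rewrite TC [in RHS](TC _ (W [::])) !T_nil.
  have IH1 : T (T (W u) (W (b :: v))) (W (c :: w)) =
      T (T (W (b :: v)) (W (c :: w))) (W u).
    by rewrite IHn 1?TC.
  have IH2 : T (T (W (a :: u)) (W v)) (W (c :: w)) =
      T (T (W v) (W (c :: w))) (W (a :: u)).
    by rewrite IHn 1?TC // (leq_trans _ le_n) //= !addnS !addSn.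
  have IH3 : T (T (W (a :: u)) (W (b :: v))) (W w) =
      T (T (W (b :: v)) (W w)) (W (a :: u)).
    by rewrite IHn 1?TC // (leq_trans _ le_n) //= !addnS !addSn.
  (* With the right-hand side commuted to [(bv * cw) * au], both sides expand by [shuffle3] into the
     same six terms, shifted cyclically. *)
  rewrite [RHS]TC !shuffle3 IH1 IH2 IH3 (TC (W (c :: w)) (W (a :: u))).
  rewrite (TC (W (b :: v)) (W (a :: u))).
  by rewrite [LHS](ACl (2*3*1*5*6*4)).
have TDr u v w : T u (v + w) = T u v + T u w by rewrite !(TC u) TDl.
have TZr c u v : T u (c *: v) = c *: T u v by rewrite !(TC u) TZl.
have T0r u : T u 0 = 0 by rewrite TC T0l.
elim/W_ind => [|k u u' Hu Hu'|u] v w.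
- by rewrite !T0l.
- by rewrite !(TDl, TZl) Hu Hu'.
elim/W_ind: v w => [|k v v' Hv Hv'|v] w.
- by rewrite T0l !T0r T0l.
- by rewrite !(TDl, TZl, TDr, TZr) Hv Hv'.
elim/W_ind: w => [|k w w' Hw Hw'|w].
- by rewrite !T0r.
- by rewrite !(TDr, TZr) Hw Hw'.
by rewrite W_assoc.
Qed.

End CorrectedShuffle.

(** * The t-shuffle product *)

Lemma malg_word (u : ht) : u = \sum_(m <- msupp u) mcoeff m u *: word m.
Proof.
rewrite {1}[u]monalgE; apply: eq_bigr => m _.
apply/malgP => k; rewrite mcoeffZ !mcoeffU fmK.
by rewrite mulr_natr.
Qed.

Lemma linear_closed_sum (P : ht -> Prop) (I : eqType) (r : seq I)
    (c : I -> {poly rat}) (F : I -> ht) :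
  P 0 -> (forall c u v, P u -> P v -> P (c *: u + v)) ->
  (forall i, i \in r -> P (F i)) -> P (\sum_(i <- r) c i *: F i).
Proof.
move=> P0 PD PF; rewrite big_seq; elim/big_rec: _ => // i x ir Px.
exact/PD/Px/PF.
Qed.

Lemma word_ind (P : ht -> Prop) :
  P 0 -> (forall c u v, P u -> P v -> P (c *: u + v)) ->
  (forall w, P (word w)) -> forall u, P u.
Proof. by move=> P0 PD Pw u; rewrite (malg_word u); apply: linear_closed_sum. Qed.

Lemma word_ext_linear (F : {fmonom letter} -> ht) :
  linear (fun u : ht => \sum_(m <- msupp u) mcoeff m u *: F m).
Proof.
move=> c u v.
(* Cancellation may shrink the support of a combination, so all three sums are taken over one common
   finite set. *)
have ext (w : ht) (d : {fset {fmonom letter}}) : (msupp w `<=` d)%fset ->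
    \sum_(m <- msupp w) mcoeff m w *: F m = \sum_(m <- d) mcoeff m w *: F m.
  move=> le; apply: big_fset_incl => // m _; rewrite -mcoeff_eq0 => /eqP->.
  by rewrite scale0r.
pose d := (msupp u `|` msupp v)%fset.
rewrite (ext u d) ?fsubsetUl// (ext v d) ?fsubsetUr// (ext _ d).
  rewrite scaler_sumr -big_split; apply: eq_bigr => m _ /=.
  by rewrite mcoeffD mcoeffZ scalerDl scalerA.
apply: fsubset_trans (msuppD_le _ _) _; apply: fsetUSS => //.
exact: msuppZ_le.
Qed.

Lemma tshuffle_linearl (v : ht) : linear (tshuffle^~ v).
Proof.
move=> c u u'; rewrite /tshuffle.
have E (w : ht) : \sum_(m <- msupp w) \sum_(n <- msupp v)
    (mcoeff m w * mcoeff n v) *: tshuffle_word m n = \sum_(m <- msupp w)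
    mcoeff m w *: (\sum_(n <- msupp v) mcoeff n v *: tshuffle_word m n).
  apply: eq_bigr => m _; rewrite scaler_sumr; apply: eq_bigr => n _.
  by rewrite scalerA.
by rewrite !E word_ext_linear.
Qed.

Lemma tshuffle_word_cons (a b : letter) (u v : seq letter) :
  tshuffle_word (a :: u) (b :: v) =
    word [:: a] * tshuffle_word u (b :: v)
    + word [:: b] * tshuffle_word (a :: u) v
    - delta u * rho a * word (b :: v) - delta v * rho b * word (a :: u).
Proof. reflexivity. Qed.

Lemma tshuffle_word_sym (u v : seq letter) :
  tshuffle_word u v = tshuffle_word v u.
Proof.
elim: u v => [|a u IHu] v; first by case: v.
elim: v => [|b v IHv]; first by [].
rewrite tshuffle_word_cons IHv IHu [RHS]tshuffle_word_cons.
by rewrite [LHS]addrAC; apply: (congr1 (fun z => z - _ - _)); apply: addrC.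
Qed.

Lemma tshuffleC : commutative tshuffle.
Proof.
move=> u v; rewrite /tshuffle exchange_big /=; apply: eq_bigr => m _.
by apply: eq_bigr => n _; rewrite mulrC tshuffle_word_sym.
Qed.

Lemma tshuffle_linearr (u : ht) : linear (tshuffle u).
Proof. by move=> c v w; rewrite !(tshuffleC u) tshuffle_linearl. Qed.

HB.instance Definition _ u :=
  GRing.isLinear.Build {poly rat} ht ht *:%R (tshuffle u) (tshuffle_linearr u).

Lemma tshuffleDl u v w : tshuffle (u + v) w = tshuffle u w + tshuffle v w.
Proof. by rewrite !(tshuffleC _ w) raddfD. Qed.

Lemma tshuffleZl c u w : tshuffle (c *: u) w = c *: tshuffle u w.
Proof. by rewrite !(tshuffleC _ w) linearZ. Qed.

Lemma tshuffle0l w : tshuffle 0 w = 0.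
Proof. by rewrite tshuffleC raddf0. Qed.

Lemma tshuffle1l : left_id (1 : ht) tshuffle.
Proof.
apply: word_ind => [|c u v Hu Hv|w]; first exact: raddf0.
  by rewrite tshuffle_linearr Hu Hv.
exact: (tshuffle1word w).1.
Qed.

Lemma word_cons (a : letter) (u : seq letter) : word (a :: u) = word [:: a] * word u.
Proof. exact: (word_cat [:: a] u). Qed.

Definition rho_coef (a : letter) : {poly rat} := if a is ly then 'X else 0.

Lemma rhoE (a : letter) : rho a = rho_coef a *: word [:: lx].
Proof. by case: a => //=; rewrite scale0r. Qed.

Lemma deltaE (w : seq letter) : delta w = (w == [::])%:R%:A.
Proof. by rewrite scaler_nat. Qed.

Definition ecoef (u : ht) : {poly rat} := mcoeff (mone : {fmonom letter}) u.

Lemma ecoef_linear : linear_for *%R ecoef.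
Proof. by move=> c u v; rewrite /ecoef mcoeffD mcoeffZ. Qed.

Lemma ecoef_word (w : seq letter) : ecoef (word w) = (w == [::])%:R.
Proof. by rewrite /ecoef mcoeffU fmP fm1. Qed.

Lemma ecoef_cons (a : letter) (u : ht) : ecoef (word [:: a] * u) = 0.
Proof. by rewrite /ecoef rmorphM /= [X in X * _](ecoef_word [:: a]) mul0r. Qed.

(** Scalars are central: a constant commutes with each word because the coefficients commute. *)
Lemma malg_scalerAr (c : {poly rat}) (u v : ht) : u * (c *: v) = c *: (u * v).
Proof.
elim/word_ind: u => [|k u u' Hu Hu'|w]; first by rewrite !mul0r scaler0.
  by rewrite !mulrDl -!scalerAl Hu Hu' scalerDr !scalerA mulrC.
rewrite -mul_malgC [LHS]mulrA -[RHS]mul_malgC [RHS]mulrA.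
apply: (congr1 (fun z : ht => z * v)).
apply: etrans (fgmulUU _ _ _ _) _.
by rewrite mulm1 mulrC -[X in << _ *g X >>]mul1m -fgmulUU.
Qed.

Lemma tshuffleA : associative tshuffle.
Proof.
apply: (@shuffle_assoc _ _ _ word ecoef rho tshuffle lx rho_coef).
- exact: malg_scalerAr.
- exact: word_ind.
- exact: word_cons.
- exact: ecoef_linear.
- exact: ecoef_word.
- exact: ecoef_cons.
- exact: rhoE.
- exact: tshuffleC.
- exact: tshuffle_linearl.
- by move=> u; rewrite word0; exact: tshuffle1l.
- exact: tshuffle_cons.
Qed.

(** * Subalgebras *)

Lemma tshuffleDr u v w : tshuffle u (v + w) = tshuffle u v + tshuffle u w.
Proof. exact: raddfD. Qed.

Lemma tshuffleZr c u v : tshuffle u (c *: v) = c *: tshuffle u v.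
Proof. exact: linearZ. Qed.

(** Both [ht1] and [ht0] are constants plus the image of a linear map; by bilinearity and the unit
    law only products inside that image remain to be checked. *)
Lemma unitization_subalgebra (q : ht -> ht) :
  linear q -> (forall v w, exists z, tshuffle (q v) (q w) = q z) ->
  is_subalgebra tshuffle (fun u => exists (c : {poly rat}) v, u = c%:A + q v).
Proof.
move=> q_lin q_mul.
have q0 : q 0 = 0.
  by have := q_lin (-1) 0 0; rewrite scaler0 addr0 scaleN1r addNr.
split.
- by exists 1, 0; rewrite q0 addr0 scale1r.
- move=> c _ _ [a [v ->]] [b [w ->]]; exists (c * a + b), (c *: v + w).
  rewrite q_lin scalerDl [c *: (_ + _)]scalerDr scalerA [LHS]addrACA.
  reflexivity.
- move=> _ _ [a [v ->]] [b [w ->]]; have [z Ez] := q_mul v w.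
  exists (a * b), (a *: w + (b *: v + z)).
  rewrite tshuffleDl (tshuffleZl a) tshuffle1l (tshuffleDr (q v)).
  rewrite tshuffleZr (tshuffleC _ 1) tshuffle1l Ez !q_lin.
  rewrite [a *: (_ + q w)]scalerDr scalerA -[LHS]addrA.
  reflexivity.
Qed.

Definition ends_y (u : ht) : Prop := exists v, u = v * word [:: ly].

Lemma ends_y0 : ends_y 0.
Proof. by exists 0; rewrite mul0r. Qed.

Lemma ends_y_linear c u v : ends_y u -> ends_y v -> ends_y (c *: u + v).
Proof. by move=> [u' ->] [v' ->]; exists (c *: u' + v'); rewrite mulrDl scalerAl. Qed.

Lemma ends_yD u v : ends_y u -> ends_y v -> ends_y (u + v).
Proof. by move=> Hu Hv; rewrite -[u]scale1r; apply: ends_y_linear. Qed.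

Lemma ends_yN u : ends_y u -> ends_y (- u).
Proof.
by move=> Hu; rewrite -scaleN1r -[_ *: _]addr0; apply: ends_y_linear ends_y0.
Qed.

Lemma ends_yM u v : ends_y v -> ends_y (u * v).
Proof. by move=> [v' ->]; exists (u * v'); rewrite mulrA. Qed.

Lemma ends_y_word w : last lx w = ly -> ends_y (word w).
Proof.
case/lastP: w => // w a; rewrite last_rcons => ->.
by exists (word w); rewrite -word_cat cats1.
Qed.

(** Each term of the recursion ends like one of the two words, and a correction ends in a whole
    word. An empty tail escapes the induction hypothesis and is treated by the unit law. *)
Lemma ends_y_tshuffle_word u v : last lx u = ly -> last lx v = ly ->
  ends_y (tshuffle (word u) (word v)).
Proof.
elim: u v => // a u IHu; elim=> // b v IHv Lu Lv.
rewrite tshuffle_cons; apply: ends_yD; first apply: ends_yD; first apply: ends_yD.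
- apply: ends_yM; case: u {IHv} => [|a' u'] in IHu Lu *.
    by rewrite word0 tshuffle1l; apply: ends_y_word.
  exact: IHu.
- apply: ends_yM; case: v {IHu} => [|b' v'] in IHv Lv *.
    by rewrite word0 tshuffleC tshuffle1l; apply: ends_y_word.
  exact: IHv.
- exact/ends_yN/ends_yM/ends_y_word.
- exact/ends_yN/ends_yM/ends_y_word.
Qed.

Lemma tshuffle_affixes (p s p' s' : seq letter) (P : ht -> Prop) :
  P 0 -> (forall c u v, P u -> P v -> P (c *: u + v)) ->
  (forall u v, P (tshuffle (word (p ++ u ++ s)) (word (p' ++ v ++ s')))) ->
  forall u v, P (tshuffle (word p * u * word s) (word p' * v * word s')).
Proof.
move=> P0 PD Pw u v; elim/word_ind: u => [|c u u' Hu Hu'|u].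
- by rewrite mulr0 mul0r tshuffle0l.
- rewrite mulrDr mulrDl malg_scalerAr -scalerAl tshuffle_linearl.
  exact: (PD c _ _ Hu Hu').
elim/word_ind: v => [|c v v' Hv Hv'|v].
- by rewrite mulr0 mul0r tshuffleC tshuffle0l.
- rewrite mulrDr mulrDl malg_scalerAr -scalerAl tshuffle_linearr.
  exact: (PD c _ _ Hv Hv').
by rewrite -!word_cat -!catA.
Qed.

Lemma ht1_subalgebra : is_subalgebra tshuffle ht1.
Proof.
apply: unitization_subalgebra => [c u v|]; first by rewrite mulrDl scalerAl.
move=> u v; rewrite -[u]mul1r -[v]mul1r -word0.
apply: (@tshuffle_affixes [::] [:: ly] [::] [:: ly] ends_y ends_y0 ends_y_linear).
by move=> {}u {}v; apply: ends_y_tshuffle_word; rewrite !last_cat.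
Qed.

Lemma ht0_subalgebra : is_subalgebra tshuffle ht0.
Proof.
apply: unitization_subalgebra => [c u v|u v].
  by rewrite mulrDr mulrDl malg_scalerAr -scalerAl.
pose P z := exists y, z = word [:: lx] * y * word [:: ly].
apply: (@tshuffle_affixes [:: lx] [:: ly] [:: lx] [:: ly] P).
- by exists 0; rewrite mulr0 mul0r.
- move=> c _ _ [y ->] [z ->]; exists (c *: y + z).
  by rewrite mulrDr mulrDl malg_scalerAr -scalerAl.
(* Both words start with [x] and [rho lx = 0]: the corrections vanish and [x] factors out on the
   left. *)
move=> {}u {}v; rewrite !cat1s tshuffle_cons /= !mulr0 !mul0r !subr0 -mulrDr.
have [z ->] : ends_y (tshuffle (word (u ++ [:: ly])) (word (lx :: v ++ [:: ly])) +
    tshuffle (word (lx :: u ++ [:: ly])) (word (v ++ [:: ly]))).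
  by apply: ends_yD; apply: ends_y_tshuffle_word; rewrite /= last_cat.
by exists z; rewrite mulrA.
Qed.

(** * Convolution of polylogarithm coefficients *)

Section Convolution.
Variable F : comNzRingType.
Implicit Types f g : nat -> F.

Definition conv f g (n : nat) : F := \sum_(i < n.+1) f i * g (n - i)%N.

Lemma convC f g : conv f g =1 conv g f.
Proof.
move=> n; rewrite /conv (reindex_inj rev_ord_inj) /=; apply: eq_bigr => i _.
by rewrite subSS subKn 1?mulrC // -ltnS.
Qed.

Lemma eq_conv f f' g g' : f =1 f' -> g =1 g' -> conv f g =1 conv f' g'.
Proof. by move=> ff' gg' n; apply: eq_bigr => i _; rewrite ff' gg'. Qed.

Lemma conv_deltal g : conv (fun n => (n == 0%N)%:R) g =1 g.
Proof.
move=> n; rewrite /conv big_ord_recl /= mul1r subn0 big1 ?addr0 // => i _.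
by rewrite mul0r.
Qed.

Lemma convDl f f' g n :
  conv (fun i => f i + f' i) g n = conv f g n + conv f' g n.
Proof. by rewrite -big_split; apply: eq_bigr => i _; rewrite mulrDl. Qed.

Lemma convZl c f g n : conv (fun i => c * f i) g n = c * conv f g n.
Proof. by rewrite /conv mulr_sumr; apply: eq_bigr => i _; rewrite mulrA. Qed.

(** Strict partial sums are multiplication of the generating series by [z / (1 - z)], which commutes
    with the product. *)
Lemma conv_partial_sum f g n :
  conv (fun i => \sum_(m < i) f m) g n = \sum_(m < n) conv f g m.
Proof.
elim: n => [|n IHn].
  by rewrite /conv big_ord_recl !big_ord0 mul0r addr0.
rewrite /conv big_ord_recl big_ord0 mul0r add0r [RHS]big_ord_recr /= -IHn.
rewrite /conv -big_split; apply: eq_bigr => i _ /=.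
by rewrite subSS big_ord_recr mulrDl.
Qed.

(* The index is a derivation of the convolution product: this is z d/dz on the
   generating series. *)
Lemma conv_derivation f g n :
  n%:R * conv f g n =
    conv (fun i => i%:R * f i) g n + conv f (fun i => i%:R * g i) n.
Proof.
rewrite /conv -big_split mulr_sumr; apply: eq_bigr => i _ /=.
have -> : n%:R = i%:R + (n - i)%:R :> F by rewrite -natrD subnKC // -ltnS.
by ring.
Qed.

End Convolution.

(** * Coefficients of t-polylogarithms and their convolution *)

Section Coefficients.
Variables (F : numFieldType) (t : F).
Implicit Types f g : nat -> F.

Definition rho_val (a : letter) : F := if a is ly then t else 0.

(** On generating series, [y] multiplies by [z / (1 - z) + t] and [x] by 1; hence [conv_step]. *)
Definition step (a : letter) f (n : nat) : F :=
  if a is ly then \sum_(m < n) f m + t * f n else f n.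

(* [phi w n] is the coefficient of [z^n] in the t-analogue of the multiple
   polylogarithm attached to [w].  Since [x / 0 = 0], it vanishes at [n = 0]
   unless [w] is empty; hence the summand [t * phi [::] n], which corresponds to
   no term of the t-polylogarithm of [y], contributes nothing to [phi [:: ly]]. *)
Fixpoint phi (w : seq letter) : nat -> F :=
  if w is a :: w' then fun n => step a (phi w') n / n%:R
  else fun n => (n == 0%N)%:R.

Lemma phi_cons a w n : phi (a :: w) n = step a (phi w) n / n%:R.
Proof. by []. Qed.

Lemma phi_cons0 a w : phi (a :: w) 0 = 0.
Proof. by rewrite phi_cons invr0 mulr0. Qed.

Lemma eq_step a f g : f =1 g -> step a f =1 step a g.
Proof.
move=> fg n; case: a => /=; rewrite fg //; congr (_ + _).
by apply: eq_bigr => m _.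
Qed.

Lemma step_linear a c f g n :
  step a (fun m => c * f m + g m) n = c * step a f n + step a g n.
Proof.
case: a => //=; rewrite big_split -mulr_sumr /=; ring.
Qed.

Lemma conv_step a f g : conv (step a f) g =1 step a (conv f g).
Proof. by case: a => // n; rewrite /step convDl convZl conv_partial_sum. Qed.

(** Multiplying back by [n] is harmless except at [n = 0], where the division by zero erased the
    value [t] of the step for the word [y]; this is the origin of the corrections. The last letter
    excludes the word [x], whose step at 0 is 1. *)
Lemma phi_head a u n : last lx (a :: u) = ly ->
  n%:R * phi (a :: u) n =
    step a (phi u) n - (u == [::])%:R * rho_val a * phi [::] n.
Proof.
rewrite phi_cons; case: n => [|n] Lu; last first.
  by rewrite mulrC divfK ?pnatr_eq0 // mulr0 subr0.
rewrite mul0r; case: u Lu => [|b u] Lu; last first.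
  by rewrite !mul0r subr0; case: a Lu => /= _; rewrite ?big_ord0 !invr0 !mulr0 ?addr0.
by case: a Lu => //= _; rewrite big_ord0; ring.
Qed.

Lemma conv_phi_cons a b u v n : last lx (a :: u) = ly -> last lx (b :: v) = ly ->
  n%:R * conv (phi (a :: u)) (phi (b :: v)) n =
    step a (conv (phi u) (phi (b :: v))) n
    + step b (conv (phi (a :: u)) (phi v)) n
    - (u == [::])%:R * rho_val a * phi (b :: v) n
    - (v == [::])%:R * rho_val b * phi (a :: u) n.
Proof.
have key c w g m : last lx (c :: w) = ly ->
    conv (fun i => i%:R * phi (c :: w) i) g m =
    step c (conv (phi w) g) m - (w == [::])%:R * rho_val c * g m.
  (* [phi [::]] is the unit of convolution, so the correction of [phi_head] can be brought under the
     convolution. *)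
  have -> : g m = conv (phi [::]) g m by rewrite conv_deltal.
  move=> Lw; rewrite -conv_step -mulNr -convZl -convDl; apply: eq_conv => // i.
  by rewrite phi_head // mulNr.
move=> Lu Lv; rewrite conv_derivation key // [X in _ + X]convC key //.
rewrite (eq_step b (convC _ _)); ring.
Qed.

Definition ev (c : {poly rat}) : F := (map_poly ratr c).[t].

Lemma ev_is_zmod_morphism : zmod_morphism ev.
Proof. by move=> c d; rewrite /ev rmorphB hornerD hornerN. Qed.

Lemma ev_is_monoid_morphism : monoid_morphism ev.
Proof.
by split=> [|c d]; [rewrite /ev rmorph1 hornerE | rewrite /ev rmorphM hornerM].
Qed.

HB.instance Definition _ :=
  GRing.isZmodMorphism.Build {poly rat} F ev ev_is_zmod_morphism.
HB.instance Definition _ :=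
  GRing.isMonoidMorphism.Build {poly rat} F ev ev_is_monoid_morphism.

Definition Phi (u : ht) (n : nat) : F :=
  mmap ev (fun m : {fmonom letter} => phi m n) u.

End Coefficients.

Lemma mmap_linear_for (K : choiceType) (R S : nzRingType) (f : {rmorphism R -> S})
    (h : K -> S) (c : R) (u v : {malg R[K]}) :
  mmap f h (c *: u + v) = f c * mmap f h u + mmap f h v.
Proof.
rewrite mmapD; congr (_ + _); rewrite (mmapEw (msuppZ_le _ _)) mmapE mulr_sumr.
by apply: eq_bigr => k _; rewrite mcoeffZ /= rmorphM mulrA.
Qed.

Section PhiTheory.
Variables (F : numFieldType) (t : F).
Local Notation Phi := (Phi t).

Lemma Phi_linear c u v n : Phi (c *: u + v) n = ev t c * Phi u n + Phi v n.
Proof. exact: mmap_linear_for. Qed.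

Lemma Phi0 n : Phi 0 n = 0.
Proof. exact: mmap0. Qed.

Lemma Phi_word w n : Phi (word w) n = phi t w n.
Proof. by rewrite /Phi mmapU /= rmorph1 mul1r. Qed.

Lemma Phi_cons a u n : Phi (word [:: a] * u) n = step t a (Phi u) n / n%:R.
Proof.
elim/word_ind: u => [|c u v Hu Hv|w].
- rewrite mulr0 Phi0; case: a => /=; rewrite ?Phi0 ?mul0r //.
  by rewrite big1 => [|i _]; rewrite ?Phi0 // mulr0 addr0 mul0r.
- rewrite mulrDr malg_scalerAr.
  rewrite (Phi_linear c (word [:: a] * u) (word [:: a] * v)).
  transitivity (ev t c * (step t a (Phi u) n / n%:R) + step t a (Phi v) n / n%:R).
    exact: (congr2 (fun x y => ev t c * x + y) Hu Hv).
  rewrite (eq_step t _ (fun m => Phi_linear c u v m)) step_linear; ring.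
- rewrite -word_cons Phi_word phi_cons.
  by rewrite (eq_step t _ (fun m => Phi_word w m)).
Qed.

Lemma PhiZ c u n : Phi (c *: u) n = ev t c * Phi u n.
Proof. by rewrite -[c *: u]addr0 Phi_linear Phi0 addr0. Qed.

Lemma PhiD u v n : Phi (u + v) n = Phi u n + Phi v n.
Proof. exact: mmapD. Qed.

Lemma PhiB u v n : Phi (u - v) n = Phi u n - Phi v n.
Proof. exact: mmapB. Qed.

Lemma ev_rho_coef a : ev t (rho_coef a) = rho_val t a.
Proof. by case: a; rewrite /ev /= ?rmorph0 ?horner0 // map_polyX hornerX. Qed.

Lemma Phi_correction (w : seq letter) a b u n :
  Phi (delta w * rho a * word (b :: u)) n =
    (w == [::])%:R * rho_val t a * phi t (b :: u) n / n%:R.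
Proof.
have -> : delta w * rho a * word (b :: u) =
    ((w == [::])%:R * rho_coef a) *: (word [:: lx] * word (b :: u)).
  by rewrite deltaE rhoE -!scalerAl mul1r -scalerAl scalerA.
rewrite PhiZ Phi_cons [step _ _ _ _]Phi_word -ev_rho_coef.
by rewrite (rmorphM (ev t)) (rmorph_nat (ev t)) [LHS]mulrA.
Qed.

Lemma Phi_tshuffle_cons a b u v n :
  Phi (tshuffle (word (a :: u)) (word (b :: v))) n =
    (step t a (Phi (tshuffle (word u) (word (b :: v)))) n
     + step t b (Phi (tshuffle (word (a :: u)) (word v))) n
     - (u == [::])%:R * rho_val t a * phi t (b :: v) n
     - (v == [::])%:R * rho_val t b * phi t (a :: u) n) / n%:R.
Proof.
have Phi4 A B C D (p q r s : F) : Phi A n = p -> Phi B n = q -> Phi C n = r ->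
    Phi D n = s -> Phi (A + B - C - D) n = p + q - r - s.
  by move=> <- <- <- <-; rewrite !PhiB PhiD.
rewrite tshuffle_cons !mulrBl mulrDl.
by apply: Phi4; [apply: Phi_cons | apply: Phi_cons | apply: Phi_correction..].
Qed.

(** Multiplied by [n], both sides satisfy the same recursion, [Phi_tshuffle_cons] and
    [conv_phi_cons]; at [n = 0] both vanish for nonempty words. The condition on the words passes to
    tails. *)
Lemma Phi_tshuffle_word u v n :
  (u == [::]) || (last lx u == ly) -> (v == [::]) || (last lx v == ly) ->
  Phi (tshuffle (word u) (word v)) n = conv (phi t u) (phi t v) n.
Proof.
elim: u v n => [|a u IHu] v n.
  by rewrite word0 tshuffle1l Phi_word conv_deltal.
elim: v n => [|b v IHv] n.
  by rewrite word0 tshuffleC tshuffle1l Phi_word convC conv_deltal.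
move=> Lu Lv; rewrite Phi_tshuffle_cons.
have [->|n_gt0] := posnP n.
  by rewrite /conv big_ord_recl big_ord0 !phi_cons0 invr0 mul0r !mulr0 addr0.
have nz : n%:R != 0 :> F by rewrite pnatr_eq0 -lt0n.
have Lu' : (u == [::]) || (last lx u == ly) by case: (u) Lu.
have Lv' : (v == [::]) || (last lx v == ly) by case: (v) Lv.
apply: (mulfI nz); rewrite mulrC divfK // conv_phi_cons; [|exact/eqP..].
rewrite (eq_step t a (fun m => IHu (b :: v) m Lu' Lv)).
by rewrite (eq_step t b (fun m => IHv m Lu Lv')).
Qed.

End PhiTheory.

(** * Expansion of the coefficients in powers of t *)

Section PhiZword.
Variables (F : numFieldType) (t : F).

Lemma phi_nseq_lx j w n : phi t (nseq j lx ++ w) n = phi t w n / n%:R ^+ j.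
Proof.
elim: j => [|j IHj]; first by rewrite expr0 divr1.
by rewrite [LHS]phi_cons /= IHj exprS invfM mulrAC mulrA.
Qed.

Lemma phi_zword_cons k s n : (0 < k)%N ->
  phi t (zword (k :: s)) n = step t ly (phi t (zword s)) n / n%:R ^+ k.
Proof.
case: k => // k _.
have -> : zword (k.+1 :: s) = nseq k lx ++ ly :: zword s.
  by rewrite -cat_rcons.
by rewrite phi_nseq_lx phi_cons exprS invfM mulrA.
Qed.

End PhiZword.

Lemma phi_zword_addn (F : numFieldType) (t : F) k l s n : (0 < l)%N ->
  phi t (zword ((k + l)%N :: s)) n = phi t (zword (l :: s)) n / n%:R ^+ k.
Proof.
move=> l_gt0; rewrite !phi_zword_cons ?addn_gt0 ?l_gt0 ?orbT //.
by rewrite exprD invfM mulrAC mulrA.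
Qed.

Lemma size_contract_le k s b : (size (contract k s b) <= (size s).+1)%N.
Proof.
elim: s k b => [|l s IHs] k [|[] b] //=; last exact: IHs.
exact: leqW (IHs _ _).
Qed.

(** The boxes are fixed by [b], so an added [k] only shifts the head. Taking [k = 0] compares with
    [contract l s b], and [l <= h] keeps contractions admissible. *)
Lemma contract_headP l s b : exists h r,
  (l <= h)%N /\ forall k, contract (k + l) s b = (k + h)%N :: r.
Proof.
elim: s l b => [|m s IHs] l b; first by exists l, [::]; split=> // k; case: b.
case: b => [|[] b] /=; first by exists l, [::].
  have [h [r [le_h E]]] := IHs (l + m)%N b.
  exists h, r; split=> [|k]; first exact: leq_trans (leq_addr _ _) le_h.
  by rewrite -addnA E.
by exists l, (contract m s b).
Qed.

Lemma contract_gt0 k s b : (0 < k)%N -> all (leq 1) s -> all (leq 1) (contract k s b).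
Proof.
elim: s k b => [|l s IHs] k b k_gt0 /=; first by case: b; rewrite /= k_gt0.
case/andP=> l_gt0 s_gt0; case: b => [|[] b] /=; rewrite ?k_gt0 //=.
  by apply: IHs; rewrite // addn_gt0 k_gt0.
exact: IHs.
Qed.

Lemma sum_tuple_bool (V : nmodType) m (G : seq bool -> V) :
  \sum_(b : m.+1.-tuple bool) G b =
    \sum_(b : m.-tuple bool) G (true :: b) + \sum_(b : m.-tuple bool) G (false :: b).
Proof.
rewrite (reindex (fun p : bool * m.-tuple bool => [tuple of p.1 :: p.2])) /=.
  by rewrite -(pair_big xpredT xpredT (fun a b => G (a :: tval b))) big_bool.
exists (fun b => (thead b, [tuple of behead b])) => [[a b] _|b _] /=.
  by rewrite theadE; congr (_, _); apply: val_inj.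
by rewrite [RHS]tuple_eta; apply: val_inj.
Qed.

(** In the step for [y], the strict partial sum is a comma and the term with [t] is a plus. *)
Lemma phi_zword_contract (F : numFieldType) (t : F) k s n :
  (0 < k)%N -> all (leq 1) s ->
  phi t (zword (k :: s)) n =
    \sum_(b : (size s).-tuple bool)
      t ^+ (size (k :: s) - size (contract k s b)) *
      phi 0 (zword (contract k s b)) n.
Proof.
elim: s k n => [|l s IHs] k n k_gt0 /=.
  move=> _; rewrite (big_pred1 [tuple]) => [|b]; last first.
    by apply/esym/eqP; rewrite [b]tuple0.
  rewrite subnn expr0 mul1r !phi_zword_cons //= mul0r addr0.
  (* The last entry has no box after it: its term with [t] lives at [n = 0] only, where [0 ^- k] is
     0. *)
  have [->|n_gt0] := posnP n; first by rewrite expr0n gtn_eqF // invr0 !mulr0.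
  by rewrite mulr0 addr0.
case/andP=> l_gt0 s_gt0; rewrite phi_zword_cons //= mulrDl addrC.
rewrite (sum_tuple_bool _ (fun b => t ^+ ((size s).+2 - size (contract k (l :: s) b)) *
  phi 0 (zword (contract k (l :: s) b)) n)).
congr (_ + _) => /=.
  (* A plus: [n ^- k] is absorbed into the head of the contraction, and losing one entry costs one
     power of [t]. *)
  rewrite IHs // mulr_sumr mulr_suml; apply: eq_bigr => b _.
  have [h [r [le_h E]]] := contract_headP l s b.
  have := size_contract_le l s b; have := E 0%N; rewrite add0n => El.
  rewrite E El /= => le_r; rewrite (phi_zword_addn 0 k) ?(leq_trans l_gt0) //.
  by rewrite !subSS subSn // exprS !mulrA.
rewrite (eq_bigr _ (fun (m : 'I_n) _ => IHs l m l_gt0 s_gt0)) exchange_big /=.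
rewrite mulr_suml; apply: eq_bigr => b _.
by rewrite phi_zword_cons //= mul0r addr0 subSS mulrA mulr_sumr.
Qed.

(** * Summability *)

Section Growth.
Variable F : rcfType.
Local Notation rt n := (Num.sqrt (n%:R : F)).

Lemma rt_gt0 n : 0 < rt n.+1.
Proof. by rewrite sqrtr_gt0 ltr0n. Qed.

Lemma rtS_sqr n : rt n.+1 ^+ 2 = rt n ^+ 2 + 1.
Proof. by rewrite !sqr_sqrtr ?ler0n // -natr1. Qed.

Lemma ler_rtS n : rt n <= rt n.+1.
Proof. by rewrite ler_sqrt ?ler0n // ler_nat. Qed.

(** Telescoping: with [s ^+ 2 = r ^+ 2 + 1] and [r <= s], one has [1 / s <= 2 * (s - r)]. The term
    [m = 0] is 0. *)
Lemma sum_rtV n : \sum_(m < n.+1) (rt m)^-1 <= 2 * rt n.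
Proof.
elim: n => [|n IHn]; first by rewrite big_ord1 sqrtr0 invr0 mulr0.
rewrite big_ord_recr /=; apply: le_trans (lerD IHn (lexx _)) _.
have s0 := rt_gt0 n; have := rtS_sqr n; have := sqrtr_ge0 (n%:R : F).
have := ler_rtS n; move: (rt n.+1) (rt n) s0 => s r s0 rs r0 E.
rewrite -(ler_pM2r s0) mulrDl mulVf ?gt_eqF //; nra.
Qed.

(** Telescoping of [1 / s ^+ 3 <= 2 / r - 2 / s]; the constant 3 gives equality at the start, where
    the sum is 1. *)
Lemma sum_rtV3 n : \sum_(m < n.+2) (rt m)^-1 / m%:R <= 3 - 2 / rt n.+1.
Proof.
elim: n => [|n IHn].
  by rewrite !big_ord_recr big_ord0 /= sqrtr0 sqrtr1 invr0 invr1; lra.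
rewrite big_ord_recr /=; apply: le_trans (lerD IHn (lexx _)) _.
have s0 := rt_gt0 n.+1; have r0 := rt_gt0 n; have := rtS_sqr n.+1.
rewrite -[X in (rt n.+2)^-1 / X]sqr_sqrtr ?ler0n //.
have := ler_rtS n.+1; move: (rt n.+2) (rt n.+1) s0 r0 => s r s0 r0 rs E.
rewrite -subr_ge0.
have -> : 3 - 2 / s - (3 - 2 / r + s^-1 / s ^+ 2) =
    (2 * (s - r) * s ^+ 2 - r) / (r * s ^+ 3).
  by field; rewrite !gt_eqF.
apply: divr_ge0; last by rewrite mulr_ge0 ?exprn_ge0 ?ltW.
have h : 1 <= 2 * (s - r) * s by nra.
have : s <= 2 * (s - r) * s * s by rewrite ler_peMl // ltW.
nra.
Qed.

Lemma phi_ge0 (t : F) w n : 0 <= t -> 0 <= phi t w n.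
Proof.
move=> t0; elim: w n => [|a w IHw] n; first exact: ler0n.
rewrite phi_cons divr_ge0 ?ler0n //; case: a => //=.
by rewrite addr_ge0 ?mulr_ge0 // sumr_ge0.
Qed.

(* The bound [C / sqrt n] is stable under both letters, as partial sums of
   [1 / sqrt m] are at most [2 * sqrt n]; a leading [x] makes it summable. *)
Lemma phi_le_rtV w : last lx w = ly ->
  exists2 C, 0 <= C & forall n, phi 0 w n <= C * (rt n)^-1.
Proof.
elim: w => // a w IHw Lw.
have aux n : (n.+1%:R)^-1 = (rt n.+1)^-1 * (rt n.+1)^-1.
  by rewrite -invfM -expr2 sqr_sqrtr ?ler0n.
have rt1 n : (rt n.+1)^-1 <= 1.
  by rewrite invf_le1 ?rt_gt0 // -[X in X <= _]sqrtr1 ler_sqrt ?ltr0n // ler1n.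
case: w => [|b w] in IHw Lw *.
  case: a Lw => // _; exists 1 => // -[|n].
    by rewrite phi_cons0 mul1r invr_ge0 sqrtr_ge0.
  rewrite phi_cons /= mul0r addr0 big_ord_recl big1 ?addr0 => [|i _] //=.
  by rewrite !mul1r aux ler_piMl // invr_ge0 sqrtr_ge0.
have [C C0 HC] := IHw Lw; exists (2 * C) => [|n]; first by rewrite mulr_ge0.
have R0 m : 0 <= (rt m)^-1 by rewrite invr_ge0 sqrtr_ge0.
case: n => [|n]; first by rewrite phi_cons0 !mulr_ge0.
rewrite phi_cons; case: a Lw => _; rewrite /step.
  apply: (@le_trans _ _ (C * (rt n.+1)^-1)); last first.
    by rewrite ler_wpM2r // ler_peMl // ler1n.
  apply: le_trans (HC n.+1); apply: ler_piMr; first exact: phi_ge0.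
  by rewrite invf_le1 ?ltr0n // ler1n.
rewrite mul0r addr0 aux mulrA ler_wpM2r // ler_pdivrMr ?rt_gt0 //.
apply: (@le_trans _ _ (\sum_(m < n.+1) C * (rt m)^-1)).
  by apply: ler_sum => i _; apply: HC.
rewrite -mulr_sumr [2 * C]mulrC -mulrA ler_wpM2l //.
by rewrite (le_trans (sum_rtV n)) // ler_wpM2l // ler_rtS.
Qed.

Lemma sum_phi_bounded w : last lx w = ly ->
  exists M, forall N, \sum_(m < N) phi 0 (lx :: w) m <= M :> F.
Proof.
move=> /phi_le_rtV[C C0 HC]; exists (C * 3) => N.
apply: (@le_trans _ _ (\sum_(m < N) C * ((rt m)^-1 / m%:R))).
  apply: ler_sum => i _; rewrite phi_cons mulrA.
  by rewrite ler_wpM2r ?invr_ge0 ?ler0n //; apply: HC.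
rewrite -mulr_sumr ler_wpM2l //.
apply: (@le_trans _ _ (\sum_(m < N.+2) (rt m)^-1 / m%:R)).
  rewrite !big_ord_recr /= -addrA lerDl.
  by rewrite addr_ge0 ?divr_ge0 ?invr_ge0 ?sqrtr_ge0 ?ler0n.
by apply: le_trans (sum_rtV3 N) _; rewrite gerBl divr_ge0 ?sqrtr_ge0 ?ler0n.
Qed.

End Growth.

(** * Multiple zeta values as series *)

Section ZetaSeries.
Variable R : realType.

Definition zeta_term (k m : seq nat) : R :=
  \prod_(i < size k) (nth 0%N m i)%:R ^- nth 0%N k i.

Lemma zeta_term_cons k s n m :
  zeta_term (k :: s) (n :: m) = n%:R ^- k * zeta_term s m.
Proof. by rewrite /zeta_term big_ord_recl. Qed.

Lemma zeta_term_ge0 k m : 0 <= zeta_term k m.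
Proof. by apply: prodr_ge0 => i _; rewrite invr_ge0 exprn_ge0. Qed.

Definition chains (n r : nat) : set (seq nat) :=
  [set m | [/\ size m = r, path gtn n m & all (leq 1) m]].

(** The set [A] for the first entry serves two cases: all of [nat] for the zeta value, and the
    integers below [n] for the inner sums. *)
Definition headed_chains (A : set nat) (r : nat) : set (seq nat) :=
  [set m | [/\ size m = r.+1, A (head 0%N m), sorted gtn m & all (leq 1) m]].

Lemma esum_headed_chains A r (f : seq nat -> \bar R) :
  (forall m, 0 <= f m)%E ->
  \esum_(m in headed_chains A r) f m =
  \esum_(n in A `&` [set n | (0 < n)%N]) \esum_(m in chains n r) f (n :: m).
Proof.
move=> f_ge0; rewrite esum_esum => [|i j _ _]; last exact: f_ge0.
apply: reindex_esum; split.
- move=> [n m] /= [[An n0] [sz pth pos]]; split=> //=; first by rewrite sz.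
  by rewrite n0.
- by move=> [n m] [n' m'] _ _ /= [-> ->].
- move=> [|n m] [//= [sz] An pth /andP[n0 pos]].
  by exists (n, m).
Qed.

Lemma chainsS n r : chains n r.+1 = headed_chains `I_n r.
Proof.
apply/seteqP; split=> -[|x m] [//= sz].
  by move=> /andP[xn pth] pos.
by move=> xn pth pos; split=> //=; rewrite xn.
Qed.

(** Summing first over the tails below a fixed first entry [n] gives the partial sum in the step for
    [y]; [c] accumulates the powers of the outer entries. *)
Lemma esum_headed_zeta_term A k s (c : R) : (0 < k)%N -> 0 <= c ->
  (forall c n, 0 <= c -> (0 < n)%N ->
    \esum_(m in chains n (size s)) (c * zeta_term s m)%:E =
    (c * \sum_(i < n) phi 0 (zword s) i)%:E) ->
  \esum_(m in headed_chains A (size s)) (c * zeta_term (k :: s) m)%:E =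
  \esum_(n in A) (c * phi 0 (zword (k :: s)) n)%:E.
Proof.
move=> k0 c0 Hs; rewrite esum_headed_chains => [|m]; last first.
  by rewrite lee_fin mulr_ge0 // zeta_term_ge0.
rewrite esum_mkcondr; apply: eq_esum => n _.
have [->|n0] := posnP n.
  rewrite memNset //= phi_zword_cons // expr0n gtn_eqF // invr0 !mulr0 //.
rewrite mem_set //.
under eq_esum do rewrite zeta_term_cons mulrA.
rewrite Hs ?mulr_ge0 ?invr_ge0 ?exprn_ge0 //.
by rewrite phi_zword_cons //= mul0r addr0 -mulrA [_^-1 * _]mulrC.
Qed.

Lemma esum_chains s c n : all (leq 1) s -> 0 <= c -> (0 < n)%N ->
  \esum_(m in chains n (size s)) (c * zeta_term s m)%:E =
  (c * \sum_(i < n) phi 0 (zword s) i)%:E.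
Proof.
elim: s c n => [|k s IHs] c n.
  move=> _ c0 n0; have -> : chains n (size (@nil nat)) = [set [::]].
    by apply/seteqP; split=> [m [/size0nil ->]|m ->].
  rewrite esum_set1 ?lee_fin ?mulr_ge0 ?zeta_term_ge0 //.
  (* As [n] is positive, the partial sum of the unit sequence contains the index 0 and equals 1, the
     empty product. *)
  rewrite /zeta_term big_ord0; case: n n0 => // n _.
  by rewrite big_ord_recl big1 ?addr0.
move=> /andP[k0 s0] c0 n0; rewrite chainsS esum_headed_zeta_term //; last first.
  by move=> d i d0 i0; apply: IHs.
rewrite esum_fset ?finite_II // => [|i _]; last first.
  by rewrite lee_fin mulr_ge0 // phi_ge0.
by rewrite -fsbig_ord sumEFin mulr_sumr.
Qed.

Lemma esum_zeta k s : (0 < k)%N -> all (leq 1) s ->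
  \esum_(m in [set m : seq nat | [/\ size m = size (k :: s), sorted gtn m
                                  & all (leq 1) m]]) (zeta_term (k :: s) m)%:E =
  \esum_(n in [set: nat]) (phi 0 (zword (k :: s)) n)%:E.
Proof.
move=> k0 s0.
transitivity (\esum_(m in headed_chains setT (size s))
                 (1 * zeta_term (k :: s) m)%:E).
  have -> : headed_chains setT (size s) = [set m | [/\ size m = size (k :: s),
      sorted gtn m & all (leq 1) m]].
    by apply/seteqP; split=> m; [case|case].
  by apply: eq_esum => m _; rewrite mul1r.
rewrite esum_headed_zeta_term //; last by move=> c n c0 n0; apply: esum_chains.
by apply: eq_esum => n _; rewrite mul1r.
Qed.

(** For [k >= 2] the word starts with [x], so the increasing partial sums are bounded; the extended
    sum is then finite and [fine] returns the limit. *)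
Lemma cvg_phi_zeta k s : (1 < k)%N -> all (leq 1) s ->
  series (phi 0 (zword (k :: s))) @ \oo --> zeta R (k :: s).
Proof.
move=> k1 s0; have k0 : (0 < k)%N := ltnW k1.
set f := phi 0 (zword (k :: s)).
have f_ge0 n : 0 <= f n by apply: phi_ge0.
have f_cvg : cvgn (series f).
  have zE : zword (k :: s) = lx :: (nseq k.-2 lx ++ ly :: zword s).
    rewrite /f; case: k k1 {k0 f f_ge0} => [|[|k]] // _.
    by rewrite -cat_rcons.
  have [|M HM] := @sum_phi_bounded R (nseq k.-2 lx ++ ly :: zword s).
    rewrite last_cat /= -[last _ _]/(last ly (flatten _)).
    elim: s s0 {f f_ge0 zE} => // l s' IH /= /andP[_ /IH E].
    by rewrite last_cat last_rcons.
  apply: nondecreasing_is_cvgn.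
    exact: (@nondecreasing_series R f xpredT 0%N).
  by exists M => _ [n _ <-]; rewrite /f zE /series /= big_mkord.
have -> : zeta R (k :: s) = limn (series f); last exact: f_cvg.
rewrite /zeta [X in fine X](esum_zeta k0 s0) -nneseries_esumT; last first.
  by move=> n; rewrite lee_fin.
under eq_fun do rewrite sumEFin.
by rewrite EFin_lim.
Qed.

End ZetaSeries.

(** * The homomorphism *)

Lemma zword_index_of n w : last lx w = ly ->
  zword (index_of n w) = nseq n lx ++ w.
Proof.
elim: w n => // -[] w IHw n Lw /=.
  rewrite IHw; last by case: (w) Lw.
  by rewrite -[in LHS]addn1 nseqD -catA.
have -> : zword (n.+1 :: index_of 0 w) = nseq n lx ++ ly :: zword (index_of 0 w).
  by rewrite -cat_rcons.
by case: w Lw IHw => // a w Lw ->.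
Qed.

(** The counter starts at the number of letters [x] already read: [n = 1], for a word with a leading
    [x], gives an admissible index. *)
Lemma index_of_headP n w : last lx w = ly ->
  exists k s, [/\ index_of n w = k :: s, (n < k)%N & all (leq 1) s].
Proof.
have pos m v : all (leq 1) (index_of m v) by elim: v m => // -[] v IHv m /=.
elim: w n => // -[] w IHw n Lw /=; last by exists n.+1, (index_of 0 w).
have [|k [s [E nk s0]]] := IHw n.+1; first by case: (w) Lw.
by exists k, s; split=> //; apply: ltnW.
Qed.

Lemma ht0_ind (P : ht -> Prop) : P 0 ->
  (forall c u v, P u -> P v -> P (c *: u + v)) -> P (word [::]) ->
  (forall w, last lx w = ly -> P (word (lx :: w))) ->
  forall u, ht0 u -> P u.
Proof.
move=> P0 PD P1 Pw _ [c [v ->]]; rewrite -word0; apply: (PD) => //.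
elim/word_ind: v => [|d v v' Hv Hv'|v].
- by rewrite mulr0 mul0r.
- rewrite mulrDr mulrDl malg_scalerAr -scalerAl.
  exact: (PD d _ _ Hv Hv').
- by rewrite -!word_cat -catA; apply: Pw; rewrite last_cat.
Qed.

(** * Cauchy products of nonnegative series *)

Section CauchyProduct.
Variable R : realType.
Implicit Types f g : nat -> R.

Lemma series_ord f n : series f n = \sum_(i < n) f i.
Proof. by rewrite /series /= big_mkord. Qed.

Lemma series_ge0_le f (a : R) n : (forall i, 0 <= f i) -> series f @ \oo --> a ->
  series f n <= a.
Proof.
move=> f0 fa; rewrite -(cvg_lim (@Rhausdorff R) fa).
apply: nondecreasing_cvgn_le; last by apply/cvg_ex; exists a.
exact: (@nondecreasing_series R f xpredT 0%N).
Qed.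

(** A triangular partial sum lies inside one rectangle of the double series, and at twice the index
    it contains that rectangle. *)
Lemma cvg_series_conv f g (a b l : R) :
  (forall i, 0 <= f i) -> (forall i, 0 <= g i) ->
  series f @ \oo --> a -> series g @ \oo --> b ->
  series (conv f g) @ \oo --> l -> l = a * b.
Proof.
move=> f0 g0 fa gb hl.
have h0 i : 0 <= conv f g i by apply: sumr_ge0 => j _; rewrite mulr_ge0.
have sE n : series (conv f g) n = \sum_(j < n.+1) g j * series f (n - j)%N.
  rewrite series_ord -conv_partial_sum convC.
  by apply: eq_bigr => j _; rewrite series_ord.
have sf_mono : {homo series f : m n / (m <= n)%N >-> m <= n}.
  exact: (@nondecreasing_series R f xpredT 0%N).
have sf0 n : 0 <= series f n by rewrite series_ord sumr_ge0.
apply/eqP; rewrite eq_le; apply/andP; split.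
  apply: (cvgr_to_le hl); near=> n.
  apply: (@le_trans _ _ (series f n * series g n.+1)).
    rewrite sE [X in _ * X]series_ord mulr_sumr; apply: ler_sum => j _.
    by rewrite mulrC ler_wpM2r // sf_mono // leq_subr.
  apply: ler_pM => //; first by rewrite series_ord sumr_ge0.
    exact: series_ge0_le.
  exact: series_ge0_le.
have fg : (fun n => series f n * series g n.+1) @ \oo --> a * b.
  by apply: cvgM => //; rewrite (cvg_shiftS (series g)).
apply: (cvgr_to_le fg); near=> n.
(* At index [n + n], the terms [j <= n] carry at least [series f n]; the others are nonnegative and
   are dropped. *)
apply: le_trans (series_ge0_le (n + n) h0 hl).
rewrite sE -addSn big_split_ord /= [in leLHS](series_ord g) mulr_sumr.
apply: ler_wpDr; last first.
  apply: ler_sum => j _; rewrite mulrC ler_wpM2l // sf_mono //.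
  by rewrite -addnBA ?leq_addr // -ltnS.
by apply: sumr_ge0 => j _; rewrite mulr_ge0.
Unshelve. all: by end_near.
Qed.

End CauchyProduct.

Lemma poly_eq_nat (R : realType) (p q : {poly R}) :
  (forall n : nat, p.[n%:R] = q.[n%:R]) -> p = q.
Proof.
move=> pq; apply/eqP; rewrite -subr_eq0; apply: contraT => nz.
pose s := [seq (n%:R : R) | n <- iota 0 (size (p - q))].
have := @max_poly_roots _ (p - q) s nz; rewrite size_map size_iota ltnn; apply.
  by apply/allP => _ /mapP[n _ ->]; rewrite rootE hornerD hornerN pq subrr.
by rewrite map_inj_uniq ?iota_uniq // => m n /eqP; rewrite eqr_nat => /eqP.
Qed.

Section ZtMorphism.
Variable R : realType.

Lemma Zt_linear c (u v : ht) :
  Zt R (c *: u + v) = qt_to_rt R c * Zt R u + Zt R v.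
Proof. exact: (@mmap_linear_for _ _ _ (map_poly ratr)). Qed.

Lemma Zt0 : Zt R 0 = 0.
Proof. exact: (@mmap0 _ _ _ (map_poly ratr)). Qed.

Lemma Zt1 : Zt R 1 = 1.
Proof. by rewrite -word0 (@Zt_zword R [::]). Qed.

Lemma cvg_phi_zetat (t : R) k s : (1 < k)%N -> all (leq 1) s ->
  series (phi t (zword (k :: s))) @ \oo --> (zetat R (k :: s)).[t].
Proof.
move=> k1 s0; have k0 := ltnW k1.
have -> : series (phi t (zword (k :: s))) = fun n =>
    \sum_(b : (size s).-tuple bool) t ^+ (size (k :: s) - size (contract k s b)) *
      series (phi 0 (zword (contract k s b))) n.
  apply/funext => n; rewrite series_ord.
  under eq_bigr do rewrite phi_zword_contract //.
  rewrite exchange_big /=; apply: eq_bigr => b _.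
  by rewrite series_ord mulr_sumr.
rewrite /zetat horner_sum; apply: cvg_big => [|b _]; first exact: add_continuous.
rewrite hornerM hornerXn hornerC; apply: cvgMl_tmp.
(* Merging can only enlarge the first entry, so every contraction is admissible and its series
   converges. *)
have [h [r [le_h /(_ 0%N)]]] := contract_headP k s b; rewrite add0n => E.
have := contract_gt0 b k0 s0; rewrite E => /andP[_ r0].
exact: cvg_phi_zeta (leq_trans k1 le_h) r0.
Qed.

Lemma cvg_phi_Zt (t : R) w : last lx w = ly ->
  series (phi t (lx :: w)) @ \oo --> (Zt R (word (lx :: w))).[t].
Proof.
move=> Lw; have Lw' : last lx (lx :: w) = ly by [].
have [k [s [E k1 s0]]] := index_of_headP 1 Lw.
have {}E : index_of 0 (lx :: w) = k :: s by [].
have wE := zword_index_of 0 Lw'; rewrite E in wE.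
rewrite -[lx :: w]wE Zt_zword; last by rewrite /= (ltnW k1).
exact: cvg_phi_zetat.
Qed.

Lemma cvg_Phi_Zt (t : R) u : ht0 u ->
  series (Phi t u) @ \oo --> (Zt R u).[t].
Proof.
move: u; apply: ht0_ind => [|c u v Hu Hv||w Lw].
- have -> : Phi t 0 = fun=> 0 by apply/funext => n; exact: Phi0.
  rewrite Zt0 horner0; have -> : series (fun=> 0 : R) = cst 0.
    by apply/funext => n; rewrite series_ord big1.
  exact: cvg_cst.
- have -> : series (Phi t (c *: u + v)) =
      fun n => ev t c * series (Phi t u) n + series (Phi t v) n.
    apply/funext => n; rewrite !series_ord mulr_sumr -big_split.
    by apply: eq_bigr => i _; rewrite Phi_linear.
  rewrite Zt_linear hornerD hornerM; apply: cvgD => //.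
  exact: cvgMl_tmp.
- rewrite {2}word0 Zt1 hornerC; apply: cvg_near_cst; exists 1%N => // -[//|n] _.
  rewrite series_ord big_ord_recl big1 ?addr0 => [|i _];
    by rewrite Phi_word.
- have -> : Phi t (word (lx :: w)) = phi t (lx :: w).
    by apply/funext => n; apply: Phi_word.
  exact: cvg_phi_Zt.
Qed.

Lemma Zt_tshuffle_word u v : last lx u = ly -> last lx v = ly ->
  Zt R (tshuffle (word (lx :: u)) (word (lx :: v))) =
  Zt R (word (lx :: u)) * Zt R (word (lx :: v)).
Proof.
(* Natural values of [t] keep all coefficients nonnegative, as the Cauchy product requires. *)
move=> Lu Lv; apply: poly_eq_nat => n; set t := n%:R.
have t0 : 0 <= t by apply: ler0n.
have ht0_word w : last lx w = ly -> ht0 (word (lx :: w)).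
  case/lastP: w => // w a; rewrite last_rcons => ->.
  exists 0, (word w).
  by rewrite scale0r add0r -!word_cat -cats1.
have [_ _ ht0M] := ht0_subalgebra.
rewrite hornerM; apply: (@cvg_series_conv R (phi t (lx :: u)) (phi t (lx :: v))).
- by move=> i; apply: phi_ge0.
- by move=> i; apply: phi_ge0.
- exact: cvg_phi_Zt.
- exact: cvg_phi_Zt.
(* The product series converges because its terms are [Phi t] of an element of [ht0], which is
   closed under the t-shuffle. *)
have -> : conv (phi t (lx :: u)) (phi t (lx :: v)) =
    Phi t (tshuffle (word (lx :: u)) (word (lx :: v))).
  by apply/funext => i; rewrite Phi_tshuffle_word //= ?Lu ?Lv.
by apply: cvg_Phi_Zt; apply: ht0M; apply: ht0_word.
Qed.

Lemma Zt_tshuffle u v : ht0 u -> ht0 v ->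
  Zt R (tshuffle u v) = Zt R u * Zt R v.
Proof.
move=> hu hv; move: u hu; apply: ht0_ind => [|c u u' Hu Hu'||u Lu].
- by rewrite tshuffle0l Zt0 mul0r.
- by rewrite tshuffle_linearl !Zt_linear Hu Hu' mulrDl mulrA.
- by rewrite word0 tshuffle1l Zt1 mul1r.
move: v hv; apply: ht0_ind => [|c v v' Hv Hv'||v Lv].
- by rewrite tshuffleC tshuffle0l Zt0 mulr0.
- by rewrite tshuffle_linearr !Zt_linear Hv Hv' mulrDr mulrCA.
- by rewrite word0 tshuffleC tshuffle1l Zt1 mulr1.
exact: Zt_tshuffle_word.
Qed.

End ZtMorphism.

Theorem theorem2p2 (R : realType) :
  [/\ [/\ commutative tshuffle,
          associative tshuffle,
          left_id (1 : ht) tshuffle,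
          (forall u : ht, linear (tshuffle u))
        & (forall v : ht, linear (tshuffle^~ v))],
      is_subalgebra tshuffle ht1,
      is_subalgebra tshuffle ht0
    & [/\ (forall (c : {poly rat}) (u v : ht), ht0 u -> ht0 v ->
             Zt R (c *: u + v) = qt_to_rt R c * Zt R u + Zt R v),
          Zt R 1 = 1
        & (forall u v : ht, ht0 u -> ht0 v ->
             Zt R (tshuffle u v) = Zt R u * Zt R v)]].
Proof.
split.
- split; first exact: tshuffleC.
  + exact: tshuffleA.
  + exact: tshuffle1l.
  + exact: tshuffle_linearr.
  + exact: tshuffle_linearl.
- exact: ht1_subalgebra.
- exact: ht0_subalgebra.
- split; last exact: Zt_tshuffle.
  + by move=> c u v _ _; apply: Zt_linear.
  + exact: Zt1.
Qed.
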